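(* For every $K\ge1$ there is a constant $C$ such that the hypercube $G$ with $n=2^d$ vertices ($d\ge1$) satisfies $\widetilde{\mathsf{EC}}(G)\le C n\log^2 n$ for every choice of rotor sequence lengths with $\tilde\kappa\le K$.
   Context: The hypercube has vertex set $\{0,1\}^d$, two vertices adjacent iff they differ in exactly one bit. Logarithms are base 2. Unweighted deterministic walk: each vertex $u$ has a rotor sequence of length $\tilde d(u)$ of neighbours of $u$, each occurring exactly $\tilde d(u)/\deg(u)$ times, and an initial rotor position; $\tilde\kappa=\max_u\tilde d(u)/\deg(u)$. The walk moves from the current vertex to the vertex its rotor points at and then advances that rotor cyclically. $\widetilde{\mathsf{EC}}(G)$ is the maximum over start vertices and all rotor sequences/initial positions (lengths fixed) of the first time every edge has been traversed. (The paper states its bounds for specific graphs under the standing assumption $\tilde\kappa=O(1)$.) *)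

(* Defs.v *)
From mathcomp Require Import all_boot all_order all_algebra.
From mathcomp Require Import all_classical all_reals all_analysis.

Set Implicit Arguments.
Unset Strict Implicit.
Unset Printing Implicit Defensive.

Import Order.TTheory GRing.Theory Num.Theory.
Local Open Scope classical_set_scope.

(* A simple graph is given by its adjacency relation [e] on a finite type.    *)
Section RotorWalk.
Variables (T : finType) (e : rel T).

Definition degree (u : T) : nat := #|[set v | e u v]%SET|.

(* The lengths for which rotor sequences exist: a rotor sequence is nonempty
   and each of the [degree u] neighbours occurs equally often in it.          *)
Definition rotor_lengths (dt : T -> nat) : Prop :=
  forall u, (0 < dt u)%N /\ (degree u %| dt u)%N.

(* For [rotor_lengths dt] the quotients below are exact.                      *)
Definition kappa (dt : T -> nat) : nat := \max_(u : T) (dt u %/ degree u)%N.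

Definition rotor_sequences (dt : T -> nat) (rho : T -> seq T) : Prop :=
  forall u, [/\ size (rho u) = dt u,
                forall v, v \in rho u -> e u v
              & forall v, e u v ->
                  count_mem v (rho u) = (dt u %/ degree u)%N].

Definition rotor_positions (dt : T -> nat) (p : T -> nat) : Prop :=
  forall u, (p u < dt u)%N.

(* A state consists of the current vertex and all current rotor positions.    *)
Definition rotor_step (rho : T -> seq T) (s : T * (T -> nat))
    : T * (T -> nat) :=
  let: (x, p) := s in
  (nth x (rho x) (p x),
   fun u => if u == x then ((p x).+1 %% size (rho x))%N else p u).

Definition rotor_walk (rho : T -> seq T) (p : T -> nat) (x : T) (t : nat) : T :=
  (iter t (rotor_step rho) (x, p)).1.

(* Edges are undirected: traversal in either direction counts.                *)
Definition edges_covered (rho : T -> seq T) (p : T -> nat) (x : T) (t : nat)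
    : Prop :=
  forall u v, e u v -> exists2 s, (s < t)%N &
    let a := rotor_walk rho p x s in
    let b := rotor_walk rho p x s.+1 in
    (a = u /\ b = v) \/ (a = v /\ b = u).

(* Extended-real valued, so that a walk that never covers the edges has cover
   time +oo (the infimum of the empty set).                                   *)
Definition edge_cover_time_from (R : realType) (rho : T -> seq T)
    (p : T -> nat) (x : T) : \bar R :=
  ereal_inf [set (t%:R)%R%:E | t in [set t | edges_covered rho p x t]].

(* Only finitely many tuples (rho, p, x) are admissible up to extensional
   equality, so this supremum is a maximum whenever [rotor_lengths dt] holds
   and there is a start vertex.                                               *)
Definition edge_cover_time (R : realType) (dt : T -> nat) : \bar R :=
  ereal_sup [set y : \bar R | exists rho p x,
    [/\ rotor_sequences dt rho, rotor_positions dt p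
      & y = edge_cover_time_from R rho p x]].

End RotorWalk.

Definition hypercube_adj (d : nat) : rel {ffun 'I_d -> bool} :=
  fun u v => #|[set i | u i != v i]%SET| == 1%N.

Definition log2 (R : realType) (x : R) : R := (ln x / ln 2)%R.

(* Main.v *)
(* Count departures: N u from the vertex u and f u v along the arc (u, v).  Let
   L be a common multiple of the numbers dt u / deg u.  If u has departed at
   least k L deg u times, then its rotor has pointed to each neighbour at least
   k L times; if fewer, at most k L times.  So every arc leaving the set S of
   vertices with N u >= k L deg u is used at least as often as its reverse, and
   as the walk leaves S at most once more than it enters S, the two counts
   differ by at most one on each edge of the cut.  Hence, for L >= 2, a
   neighbour v of S satisfies N v >= (k - 1) L deg v.  On the hypercube, after
   2^d d (d + 1) L steps some vertex has N u >= (d + 1) L d by averaging, so all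
   vertices satisfy N v >= L deg v, and all arcs have been used. *)
Require Import Defs.
From mathcomp Require Import all_boot all_order all_algebra.
From mathcomp Require Import all_classical all_reals all_analysis.
From mathcomp Require Import zify.

Set Implicit Arguments.
Unset Strict Implicit.
Unset Printing Implicit Defensive.

Import Order.TTheory GRing.Theory Num.Theory.
Local Open Scope ring_scope.

(** * Occurrences of a symbol in a periodically repeated sequence *)

Section PeriodicCounts.
Variables (T : eqType) (x0 : T) (s : seq T) (a : T).

Let W N := (\sum_(j < N) (nth x0 s (j %% size s) == a))%N.

Lemma periodic_count_period N : W (N + size s) = (W N + count_mem a s)%N.
Proof.
rewrite /W addnC big_split_ord /= addnC; congr addn.
  by apply: eq_bigr => j _; rewrite modnDl.
rewrite -sum1_count (big_nth x0) big_mkord [RHS]big_mkcond /=.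
by apply: eq_bigr => j _; rewrite modn_small //; case: eqP.
Qed.

Lemma periodic_count_mul q N :
  W (N + q * size s) = (W N + q * count_mem a s)%N.
Proof.
elim: q => [|q IH]; first by rewrite !mul0n !addn0.
by rewrite !mulSnr !addnA periodic_count_period IH.
Qed.

Lemma periodic_count_leq M N : (M <= N)%N -> (W M <= W N)%N.
Proof.
move=> /subnKC <-; rewrite /W big_split_ord /=; exact: leq_addr.
Qed.

End PeriodicCounts.

(** * Departures and arc traversals of a rotor walk *)

Section RotorCounts.
Variables (T : finType) (rho : T -> seq T) (p : T -> nat) (x : T).

Let walk := rotor_walk rho p x.

Definition departures t u : nat := (\sum_(s < t) (walk s == u))%N.

Definition traversals t u v : nat :=
  (\sum_(s < t) ((walk s == u) && (walk s.+1 == v)))%N.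

Lemma departuresS t u :
  departures t.+1 u = (departures t u + (walk t == u))%N.
Proof. by rewrite /departures big_ord_recr. Qed.

Lemma sum_departures t : (\sum_u departures t u)%N = t.
Proof.
rewrite /departures exchange_big /= -[RHS]card_ord -sum1_card.
apply: eq_bigr => s _; rewrite (bigD1 (walk s)) //= eqxx big1 // => u.
by rewrite eq_sym => /negbTE ->.
Qed.

Lemma traversals_gt0 t u v : (0 < traversals t u v)%N ->
  exists2 s, (s < t)%N & walk s = u /\ walk s.+1 = v.
Proof.
rewrite lt0n sum_nat_eq0 => /forallPn[s]; rewrite eqb0 negbK.
by case/andP=> /eqP us /eqP vs; exists s.
Qed.

(* Leaving and entering the set alternate. *)
Lemma cut_traversals (S : pred T) t :
  (\sum_(w | S w.1 && ~~ S w.2) traversals t w.1 w.2 <=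
   (\sum_(w | S w.1 && ~~ S w.2) traversals t w.2 w.1).+1)%N.
Proof.
pose cr s (w : T * T) : nat := (walk s == w.1) && (walk s.+1 == w.2).
pose out s := (\sum_(w | S w.1 && ~~ S w.2) cr s w)%N.
pose inn s := (\sum_(w | S w.1 && ~~ S w.2) cr s (w.2, w.1))%N.
have sum1 (P : pred (T * T)) a : (\sum_(w | P w) (a == w) = P a)%N.
  case Pa: (P a); last first.
    by rewrite big1 // => w Pw; case: eqP => // aw; rewrite aw Pw in Pa.
  rewrite (bigD1 a) //= eqxx big1 // => w /andP[_].
  by rewrite eq_sym => /negbTE ->.
have outE s : out s = S (walk s) && ~~ S (walk s.+1).
  rewrite -[RHS](sum1 (fun w => S w.1 && ~~ S w.2) (walk s, walk s.+1)).
  by apply: eq_bigr => -[a b] _.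
have innE s : inn s = S (walk s.+1) && ~~ S (walk s).
  rewrite -[RHS](sum1 (fun w => S w.1 && ~~ S w.2) (walk s.+1, walk s)).
  by apply: eq_bigr => -[a b] _; rewrite /cr xpair_eqE andbC.
(* Telescoping: an exit takes membership in [S] from 1 to 0 and an entry from 0 to 1. The membership
   of the start, at most 1, is the successor in the claim. *)
suff bal : (\sum_(s < t) out s + S (walk t) = \sum_(s < t) inn s + S (walk 0))%N.
  rewrite /traversals [X in (X <= _)%N]exchange_big.
  rewrite [X in (_ <= X.+1)%N]exchange_big /=.
  rewrite (leq_trans (leq_addr (S (walk t)) _)) // bal -addn1 leq_add2l.
  exact: leq_b1.
elim: t => [|t IH]; first by rewrite !big_ord0.
rewrite !big_ord_recr /= addnAC addnAC -[RHS]addnAC -IH outE innE -!addnA.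
by congr addn; case: (S (walk t)); case: (S (walk t.+1)).
Qed.

Section AdmissibleRotors.
Variables (e : rel T) (dt : T -> nat).
Hypotheses (e_sym : symmetric e) (dtP : rotor_lengths e dt).
Hypotheses (rhoP : rotor_sequences e dt rho) (pP : rotor_positions dt p).

Lemma size_rho u : size (rho u) = dt u.
Proof. by case: (rhoP u). Qed.

Lemma rotor_position_departures t u :
  (iter t (rotor_step rho) (x, p)).2 u = ((p u + departures t u) %% dt u)%N.
Proof.
elim: t => [|t IH].
  by rewrite /= /departures big_ord0 addn0 modn_small.
rewrite iterS departuresS /walk /rotor_walk.
case: (iter t _ _) IH => y q /= IH; rewrite eq_sym.
case: eqVneq => [yu|_]; last by rewrite addn0.
by rewrite yu IH size_rho addn1 addnS -[(_ %% _).+1]addn1 modnDml addn1.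
Qed.

Lemma walkS t u : walk t = u ->
  walk t.+1 = nth u (rho u) ((p u + departures t u) %% size (rho u))%N.
Proof.
move=> tu; rewrite size_rho -rotor_position_departures.
move: tu; rewrite /walk /rotor_walk iterS.
by case: (iter t _ _) => y q /= ->.
Qed.

(** The rotor at [u] starts at entry [p u] and advances once per departure, so the departures read
    consecutive entries of the repeated sequence. The [p u] entries before the start are added on
    both sides to avoid a subtraction. *)
Lemma traversals_departures t u v :
  (\sum_(j < p u) (nth u (rho u) (j %% size (rho u)) == v) + traversals t u v
   = \sum_(j < p u + departures t u)
       (nth u (rho u) (j %% size (rho u)) == v))%N.
Proof.
elim: t => [|t IH].
  by rewrite /traversals /departures !big_ord0 !addn0.
rewrite /traversals big_ord_recr /= addnA IH departuresS.
case: (eqVneq (walk t) u) => [tu|_]; last by rewrite !addn0.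
by rewrite addn1 addnS big_ord_recr /= (walkS tu).
Qed.

(** Any window of [q] full rotor rounds, wherever it starts, contains [v] exactly [q] times its
    multiplicity. *)
Lemma traversals_geq q t u v : e u v ->
  (q * dt u <= departures t u)%N ->
  (q * (dt u %/ degree e u) <= traversals t u v)%N.
Proof.
move=> uv le_q; have [_ _ /(_ v uv) <-] := rhoP u.
rewrite -(leq_add2l (\sum_(j < p u) (nth u (rho u) (j %% size (rho u)) == v))).
rewrite traversals_departures -periodic_count_mul.
by apply: periodic_count_leq; rewrite leq_add2l size_rho.
Qed.

Lemma traversals_leq q t u v : e u v ->
  (departures t u <= q * dt u)%N ->
  (traversals t u v <= q * (dt u %/ degree e u))%N.
Proof.
move=> uv le_q; have [_ _ /(_ v uv) <-] := rhoP u.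
rewrite -(leq_add2l (\sum_(j < p u) (nth u (rho u) (j %% size (rho u)) == v))).
rewrite traversals_departures -periodic_count_mul.
by apply: periodic_count_leq; rewrite leq_add2l size_rho.
Qed.

Lemma walk_adj t : e (walk t) (walk t.+1).
Proof.
have [_ + _] := rhoP (walk t); apply; rewrite (walkS erefl).
by rewrite mem_nth // ltn_mod size_rho; case: (dtP (walk t)).
Qed.

Lemma traversals_eq0 t u v : ~~ e u v -> traversals t u v = 0%N.
Proof.
move=> uv; apply/eqP; rewrite -leqn0 leqNgt; apply: contra uv.
by move=> /traversals_gt0[s _ [<- <-]]; exact: walk_adj.
Qed.

Variable L : nat.
Hypotheses (L_gt1 : (1 < L)%N) (dvdL : forall u, (dt u %/ degree e u %| L)%N).

(** The number [q] of full rotor rounds depends on [u], but the resulting count [k * L] per arc does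
    not; this makes arcs at different vertices comparable. *)
Lemma common_period k u :
  exists q, (k * L = q * (dt u %/ degree e u))%N /\
            (k * L * degree e u = q * dt u)%N.
Proof.
exists (k * L %/ (dt u %/ degree e u))%N.
have kL : (dt u %/ degree e u %| k * L)%N by rewrite dvdn_mull.
have dtE : (dt u %/ degree e u * degree e u = dt u)%N.
  by apply/divnK; case: (dtP u).
by split; [rewrite divnK | rewrite -[X in _ = (_ * X)%N]dtE mulnA divnK].
Qed.

Lemma traversals_geq_mul k t u v : e u v ->
  (k * L * degree e u <= departures t u)%N -> (k * L <= traversals t u v)%N.
Proof. by have [q [-> ->]] := common_period k u; exact: traversals_geq. Qed.

Lemma traversals_leq_mul k t u v : e u v ->
  (departures t u <= k * L * degree e u)%N -> (traversals t u v <= k * L)%N.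
Proof. by have [q [-> ->]] := common_period k u; exact: traversals_leq. Qed.

Lemma departures_neighbour k t u v : e u v ->
  (k.+1 * L * degree e u <= departures t u)%N ->
  (k * L * degree e v <= departures t v)%N.
Proof.
move=> uv uS; pose S w := (k.+1 * L * degree e w <= departures t w)%N.
have [vS|vS] := boolP (S v).
  by apply: leq_trans vS; rewrite !leq_mul.
have rev_leq w : S w.1 && ~~ S w.2 ->
    (traversals t w.2 w.1 <= traversals t w.1 w.2)%N.
  (* The cut sums range over all pairs of vertices; pairs that are not edges contribute 0 to
     both. *)
  case: w => a b /= /andP[aS bS]; have [ab|ab] := boolP (e a b); last first.
    by rewrite !traversals_eq0 // e_sym.
  apply: (@leq_trans (k.+1 * L)); last exact: traversals_geq_mul.
  by apply: traversals_leq_mul; rewrite 1?e_sym // ltnW // ltnNge.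
have uvS : S (u, v).1 && ~~ S (u, v).2 by rewrite /S uS.
have := cut_traversals S t.
(* All other pairs of the cut favour the outward direction, so the surplus of at most one bounds the
   pair [(u, v)] alone. *)
rewrite (bigD1 (u, v)) //= [X in (_ <= X.+1)%N -> _](bigD1 (u, v)) //=.
have := @leq_sum _ (index_enum _) (fun w => (S w.1 && ~~ S w.2) && (w != (u, v)))
  (fun w => traversals t w.2 w.1) (fun w => traversals t w.1 w.2)
  (fun w wS => rev_leq w (proj1 (andP wS))).
set A := (\sum_(w | _) traversals t w.2 w.1)%N.
set B := (\sum_(w | _) traversals t w.1 w.2)%N => AB cut.
have uv_geq : (k.+1 * L <= traversals t u v)%N by exact: traversals_geq_mul.
rewrite leqNgt; apply/negP => v_lt.
have vu_leq : (traversals t v u <= k * L)%N.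
  by apply: traversals_leq_mul; rewrite 1?e_sym // ltnW.
(* Otherwise [(k + 1) * L <= k * L + 1], contrary to [1 < L]. *)
move: uv_geq; rewrite mulSn; lia.
Qed.

End AdmissibleRotors.
End RotorCounts.

(** * Spreading departures over the hypercube *)

Section Hypercube.
Variable d : nat.
Local Notation cube := {ffun 'I_d -> bool}.
Local Notation adj := (@hypercube_adj d).

Definition flip (u : cube) (i : 'I_d) : cube := [ffun j => u j (+) (j == i)].

Lemma hypercube_adj_sym : symmetric adj.
Proof.
move=> u v; rewrite /hypercube_adj; congr (_ == _).
by apply: eq_card => i; rewrite !inE eq_sym.
Qed.

Lemma hypercube_adj_flip u i : adj (flip u i) u.
Proof.
rewrite /hypercube_adj; apply/cards1P; exists i; apply/setP => j.
by rewrite !inE ffunE; case: (j == i); case: (u j).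
Qed.

Lemma degree_hypercube_leq u : (degree adj u <= d)%N.
Proof.
rewrite -[X in (_ <= X)%N]card_ord -cardsT.
apply: leq_trans (leq_imset_card (flip u) _); apply: subset_leq_card.
apply/fintype.subsetP => v; rewrite inE => /cards1P[i uvi].
apply/imsetP; exists i => //; apply/ffunP => j; rewrite ffunE.
have := congr1 (fun A : {set 'I_d} => j \in A) uvi; rewrite !inE => <-.
by case: (u j); case: (v j).
Qed.

(** Flipping one differing bit of [v] works; this drives the induction on the Hamming distance from
    a busy vertex. *)
Lemma hypercube_closer (u v : cube) h : #|[set i | u i != v i]%SET| = h.+1 ->
  exists2 w, adj w v & #|[set i | u i != w i]%SET| = h.
Proof.
move=> uvh.
have /card_gt0P[i iuv] : (0 < #|[set i | u i != v i]%SET|)%N by rewrite uvh.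
exists (flip v i); first exact: hypercube_adj_flip.
rewrite (cardsD1 i) iuv add1n in uvh; case: uvh => <-.
apply: eq_card => j; rewrite !inE ffunE; move: iuv; rewrite inE.
by case: (eqVneq j i) => [->|_] /=; [case: (u i); case: (v i) | rewrite addbF].
Qed.

Lemma hypercube_edges_covered dt rho p x L :
  rotor_lengths adj dt -> rotor_sequences adj dt rho -> rotor_positions dt p ->
  (1 < L)%N -> (forall u, (dt u %/ degree adj u %| L)%N) ->
  edges_covered adj rho p x (2 ^ d * (d.+1 * L * d)).
Proof.
move=> dtP rhoP pP L_gt1 dvdL; set t := (2 ^ d * _)%N.
have [u uN] : exists u, (d.+1 * L * d <= departures rho p x t u)%N.
  (* If all counts were smaller, summing their successors would give [t + 2 ^ d <= t]. *)
  apply/existsP; apply: contraT => /existsPn noN.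
  have : (\sum_(u : cube) (departures rho p x t u).+1 <=
          \sum_(u : cube) d.+1 * L * d)%N.
    by apply: leq_sum => u _; rewrite ltnNge noN.
  under eq_bigr do rewrite -addn1.
  rewrite big_split /= sum_departures !sum_nat_const card_ffun card_bool card_ord.
  by rewrite muln1 -/t -[X in (_ <= X)%N]addn0 leq_add2l leqn0 expn_eq0.
(* Each unit of distance costs one multiple of [L]; distances are at most [d], so a factor of at
   least 1 remains everywhere. *)
have far h (v : cube) : #|[set i | u i != v i]%SET| = h ->
    ((d.+1 - h) * L * degree adj v <= departures rho p x t v)%N.
  elim: h v => [|h IH] v uv.
    have -> : v = u.
      apply/ffunP => i; have := cards0_eq uv => /setP/(_ i).
      by rewrite !inE => /negbFE/eqP.
    apply: leq_trans uN; rewrite subn0 leq_mul2l degree_hypercube_leq.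
    by rewrite orbT.
  have h_leq : (h < d)%N.
    by rewrite -[X in (_ <= X)%N]card_ord -uv max_card.
  have [w wv /IH] := hypercube_closer uv.
  rewrite subSS subSn ?(ltnW h_leq) //.
  exact: (departures_neighbour hypercube_adj_sym dtP rhoP pP L_gt1 dvdL wv).
move=> v w vw.
have : (1 * L <= traversals rho p x t v w)%N.
  apply: (traversals_geq_mul dtP rhoP pP dvdL vw).
  apply: leq_trans (far _ v erefl); rewrite !leq_mul // subn_gt0 ltnS.
  by rewrite -[X in (_ <= X)%N]card_ord max_card.
rewrite mul1n => /(leq_trans (ltnW L_gt1))/traversals_gt0[s st [sv sw]].
by exists s => //; left.
Qed.

End Hypercube.

Theorem theorem3p16 (R : realType) (K : R) (hK : 1 <= K) :
  exists C : R, forall (d : nat), (1 <= d)%N ->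
    let n : R := (2 ^ d)%N%:R in
    forall dt : {ffun 'I_d -> bool} -> nat,
      rotor_lengths (@hypercube_adj d) dt ->
      (kappa (@hypercube_adj d) dt)%:R <= K ->
      (edge_cover_time (@hypercube_adj d) R dt
         <= (C * n * log2 n ^+ 2)%:E)%E.
Proof.
have K0 : 0 <= K by exact: le_trans hK.
(* Each ratio [dt u %/ degree u] lies between 1 and [M], hence divides the factorial. Taking [M.+1]
   makes [L] at least 2 even for [K = 1]. *)
pose M := Num.truncn K; pose L := (M.+1)`!.
(* The factor 2 absorbs [d + 1 <= 2 * d]. *)
exists (2 * L)%:R => d d_gt0 n dt dtP dtK.
have L_gt1 : (1 < L)%N.
  apply: leq_trans (fact_geq _); by rewrite ltnS /M truncn_gt0.
have dvdL u : (dt u %/ degree (@hypercube_adj d) u %| L)%N.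
  have [dt_gt0 dvd_dt] := dtP u.
  apply: dvdn_fact; rewrite divn_gt0 ?(dvdn_leq dt_gt0) ?(dvdn_gt0 dt_gt0) //=.
  rewrite ltnW // ltnS truncn_ge_nat //; apply: le_trans dtK.
  by rewrite ler_nat /kappa (leq_bigmax u).
apply: ge_ereal_sup => _ [rho [p [x [rhoP pP ->]]]].
apply: (@le_trans _ _ (2 ^ d * (d.+1 * L * d))%N%:R%:E).
  apply: ereal_inf_lbound; exists (2 ^ d * (d.+1 * L * d))%N => //.
  exact: hypercube_edges_covered.
have -> : log2 n = d%:R.
  rewrite /log2 /n natrX lnXn // -[_ *+ d]mulr_natl mulfK //.
  by rewrite gt_eqF // ln_gt0 // ltr1n.
rewrite lee_fin /n -natrX -!natrM ler_nat; nia.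
Qed.
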